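(* Let $n \ge 2$ be an integer and let $G = G_{2^n+1,2}$. Then $\chi(G[W]) = \chi(G) = n+1$, where \[ W = \{(x,y) : 1 \le x < y \le 2^n+1 \text{ and } \{x,y\} \subseteq I_\ell \text{ for some } \ell \in \{0,1,\dots,n\}\}, \] and $I_\ell = [\,2^\ell,\; 2^n - 2^{n-\ell} + 2\,]$ for $0 \le \ell \le n$.
   Context: For integers $p \le q$, $[p,q]$ denotes $\{p,p+1,\dots,q\}$. For an integer $N \ge 5$, the shift graph $G_{N,2}$ has as vertices the ordered pairs $(x,y)$ of integers with $1 \le x < y \le N$, and two vertices $(x,y)$ and $(y,z)$ are adjacent whenever $x<y<z$ (these are the only edges). $G[W]$ denotes the subgraph of $G$ induced by $W$. *)

(* Defs.v *)
From HB Require Import structures.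
From mathcomp Require Import all_boot.

Set Implicit Arguments.
Unset Strict Implicit.
Unset Printing Implicit Defensive.

Record sgraph := SGraph {
  vertex :> finType;
  edge : rel vertex;
  edge_sym : symmetric edge;
  edge_irr : irreflexive edge
}.

Section Graphs.
Variable G : sgraph.

Definition proper_coloring (k : nat) (f : {ffun G -> 'I_k}) : bool :=
  [forall u, forall v, edge u v ==> (f u != f v)].

Definition colorable (k : nat) : bool :=
  [exists f : {ffun G -> 'I_k}, proper_coloring f].

Lemma colorable_ex : exists k, colorable k.
Proof.
exists #|G|; apply/existsP; exists [ffun v => enum_rank v].
apply/'forall_forallP => u v; apply/implyP => uv; rewrite !ffunE.
by apply: contraTneq uv => /enum_rank_inj ->; rewrite edge_irr.
Qed.

Definition chromatic_number : nat := ex_minn colorable_ex.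

Variable W : {set G}.

Definition induced_edge : rel {v : G | v \in W} :=
  [rel u v | edge (val u) (val v)].

Lemma induced_edge_sym : symmetric induced_edge.
Proof. by move=> u v; apply: edge_sym. Qed.

Lemma induced_edge_irr : irreflexive induced_edge.
Proof. by move=> u; apply: edge_irr. Qed.

Definition induced : sgraph := SGraph induced_edge_sym induced_edge_irr.

End Graphs.

Section ShiftGraph.
Variable N : nat.

(* 'I_N.+1 ranges over 0..N, so that the points keep their labels 1..N. *)
Definition shift_vertex : finType :=
  {p : 'I_N.+1 * 'I_N.+1 | (1 <= p.1) && (p.1 < p.2)}.

Definition fst_pt (v : shift_vertex) : nat := (val v).1.
Definition snd_pt (v : shift_vertex) : nat := (val v).2.

Definition shift_edge : rel shift_vertex :=
  [rel u v | (snd_pt u == fst_pt v) || (snd_pt v == fst_pt u)].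

Lemma shift_edge_sym : symmetric shift_edge.
Proof. by move=> u v; apply: orbC. Qed.

Lemma shift_edge_irr : irreflexive shift_edge.
Proof.
move=> u; rewrite /shift_edge /= orbb; case/andP: (valP u) => _.
by rewrite ltn_neqAle eq_sym => /andP[/negbTE].
Qed.

Definition shift_graph : sgraph := SGraph shift_edge_sym shift_edge_irr.

End ShiftGraph.

(* Membership of i in I_l; both truncated subtractions are exact for l <= n. *)
Definition in_I (n l i : nat) : bool := 2 ^ l <= i <= 2 ^ n - 2 ^ (n - l) + 2.

Definition W (n : nat) : {set shift_graph (2 ^ n + 1)} :=
  [set v | [exists l : 'I_n.+1, in_I n l (fst_pt v) && in_I n l (snd_pt v)]].

(* Main.v *)
(* Suppose [G[W]] is coloured with [n] colours and let [A_p] be the set of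
   colours of the arcs leaving the point [p].  Then [A_i] is not contained in
   [A_j] whenever [i < j] lie in a common [I_l].  Among all families of subsets
   of the [n] colours with this property, pick one in which the sets at
   [p <= 2 ^ n.-1] are as large, and the others as small, as possible.
   If [p <= 2 ^ n.-1] and [T] contains [A_p], the first [q] with [A_q] inside
   [T] must satisfy [A_q = T], so all the [2 ^ k] supersets of [A_p] occur at or
   before [p], where [k] is the number of colours missing from [A_p]; the dual
   statement holds on the other side.  Hence [p] lies in [I_k], where every set
   missing [k] colours occurs at most once, and [2 ^ n + 1] points inject into
   [2 ^ n] sets.  Conversely, [(x, y)] is coloured by a binary digit that is 0
   in [x] and 1 in [y]. *)
Require Import Defs.
From mathcomp Require Import all_boot.
From mathcomp Require Import zify.

Set Implicit Arguments.
Unset Strict Implicit.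
Unset Printing Implicit Defensive.

(** * Colourings and the chromatic number *)

Section ChromaticNumber.
Variable G : sgraph.

Lemma chromatic_number_colorable : colorable G (chromatic_number G).
Proof. by rewrite /chromatic_number; case: ex_minnP. Qed.

Lemma chromatic_number_le k : colorable G k -> chromatic_number G <= k.
Proof. by rewrite /chromatic_number; case: ex_minnP => m _; apply. Qed.

Lemma colorableP k :
  reflect (exists f : G -> 'I_k, forall u v, edge u v -> f u != f v)
          (colorable G k).
Proof.
apply: (iffP existsP) => [[f /'forall_forallP fP]|[f fP]].
  by exists f => u v; apply/implyP.
exists [ffun v => f v]; apply/'forall_forallP => u v.
by apply/implyP => /fP; rewrite !ffunE.
Qed.

Lemma colorable_widen k m : k <= m -> colorable G k -> colorable G m.
Proof.
move=> lekm /colorableP[f fP]; apply/colorableP.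
by exists (fun v => widen_ord lekm (f v)) => u v /fP.
Qed.

End ChromaticNumber.

Lemma colorable_induced (G : sgraph) (U : {set G}) k :
  colorable G k -> colorable (induced U) k.
Proof.
move=> /colorableP[f fP]; apply/colorableP.
by exists (fun v => f (val v)) => u v /fP.
Qed.

(** * Upper bound from binary digits *)

(** Either the halves already differ, and induction applies to them, or they agree and the last
    digit decides. *)
Lemma digit_ltn m x y : x < y -> y < 2 ^ m ->
  exists k : 'I_m, ~~ odd (x %/ 2 ^ k) && odd (y %/ 2 ^ k).
Proof.
elim: m x y => [|m IHm] x y ltxy; rewrite ?expnS => lty; first by lia.
have [lt2|ge2] := ltnP (x %/ 2) (y %/ 2).
  have [|k kP] := IHm _ _ lt2; first by lia.
  by exists (lift ord0 k); rewrite lift0 expnS !divnMA.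
by exists ord0; rewrite /= !divn1; lia.
Qed.

Lemma shift_graph_colorable N m : N < 2 ^ m -> colorable (shift_graph N) m.
Proof.
move=> ltN; apply/colorableP.
pose digit (v : shift_graph N) (k : 'I_m) :=
  ~~ odd (fst_pt v %/ 2 ^ k) && odd (snd_pt v %/ 2 ^ k).
have digit_ex v : exists k, digit v k.
  apply: digit_ltn; first by case/andP: (valP v).
  exact: leq_ltn_trans (leq_ord _) ltN.
exists (fun v => xchoose (digit_ex v)) => u v uv; apply/eqP => eq_uv.
have /andP[u0 u1] := xchooseP (digit_ex u).
have /andP[v0 v1] := xchooseP (digit_ex v).
rewrite eq_uv in u0 u1.
(* The shared point would have digit 1 as the end of one arc and 0 as the start of the other. *)
by case/orP: uv => /eqP eqp; [move: u1 v0 | move: v1 u0]; rewrite eqp => ->.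
Qed.

(** * Extremal families of sets *)

Section SetSequences.
Variables (T : finType) (N : nat).

Lemma card_supersets (S : {set T}) :
  #|[set X : {set T} | S \subset X]| = 2 ^ #|~: S|.
Proof.
rewrite -card_powerset -(card_imset _ (@setC_inj T)); apply: eq_card => X.
rewrite powersetE; apply/imsetP/idP => [[Y]|sXS].
  by rewrite inE => sSY ->; rewrite setCS.
by exists (~: X); rewrite ?setCK // inE -setCS setCK.
Qed.

(** [A] is an arbitrary function, so that the count also serves for a reversed and complemented
    family. *)
Lemma supersets_occur_before (A : 'I_N -> {set T}) (p : 'I_N) :
    (forall (q : 'I_N) (X : {set T}), q <= p -> A q \proper X ->
       exists2 i : 'I_N, i < q & A i \subset X) ->
  2 ^ #|~: A p| <= p.+1.
Proof.
move=> Amax; rewrite -card_supersets.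
have occ (X : {set T}) : A p \subset X -> exists2 q : 'I_N, q <= p & A q = X.
  move=> sX; pose P (q : 'I_N) := A q \subset X.
  have [q Pq minq] := arg_minnP (P := P) (fun q => nat_of_ord q) sX.
  have leqp := minq p sX; exists q => //.
  apply/eqP/contraT => neq; have [|i ltiq Pi] := Amax q X leqp.
    by rewrite properEneq neq.
  by have := minq i Pi; rewrite leqNgt ltiq.
pose B := [set A (widen_ord (ltn_ord p) i) | i in 'I_p.+1].
apply: (@leq_trans #|B|).
  apply/subset_leq_card/subsetP => X; rewrite inE => /occ[q leqp <-].
  apply/imsetP; exists (inord q) => //; congr (A _).
  by apply: val_inj; rewrite /= inordK.
by rewrite (leq_trans (leq_imset_card _ _)) // card_ord.
Qed.

Variable linked : rel 'I_N.

Definition admissible (A : {ffun 'I_N -> {set T}}) :=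
  [forall i : 'I_N, forall j : 'I_N,
     (i < j) && linked i j ==> ~~ (A i \subset A j)].

Lemma admissibleP (A : {ffun 'I_N -> {set T}}) :
  reflect (forall i j : 'I_N, i < j -> linked i j -> ~~ (A i \subset A j))
          (admissible A).
Proof.
apply: (iffP 'forall_forallP) => AP i j.
  by move=> ltij lij; have /implyP := AP i j; apply; rewrite ltij.
by apply/implyP => /andP[]; apply: AP.
Qed.

Lemma admissible_extremal (L : pred 'I_N) A0 : admissible A0 ->
  exists2 A, admissible A &
    (forall p (X : {set T}), L p -> A p \proper X ->
       exists2 i : 'I_N, i < p & linked i p && (A i \subset X)) /\
    (forall p (X : {set T}), ~~ L p -> X \proper A p ->
       exists2 j : 'I_N, p < j & linked p j && (X \subset A j)).
Proof.
move=> adm0.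
(* Counting elements on [L] and missing elements off [L] turns both size requirements into one
   maximum. *)
pose weight (A : {ffun 'I_N -> {set T}}) :=
  \sum_p (if L p then #|A p| else #|~: A p|).
have [A admA maxA] := arg_maxnP (P := admissible) weight adm0.
have /admissibleP AP := admA; exists A => //.
pose upd p (X : {set T}) : {ffun 'I_N -> {set T}} :=
  [ffun q => if q == p then X else A q].
have upd_not_adm p (X : {set T}) :
    (if L p then #|A p| else #|~: A p|) < (if L p then #|X| else #|~: X|) ->
    ~~ admissible (upd p X).
  move=> lt_pX; apply/negP => /maxA; apply/negP; rewrite -ltnNge /weight.
  rewrite (bigD1 p) //= [X in _ < X](bigD1 p) //= ffunE eqxx.
  rewrite [X in _ < _ + X]
    (eq_bigr (fun q => if L q then #|A q| else #|~: A q|)).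
    by rewrite ltn_add2r.
  by move=> q /negbTE neq; rewrite ffunE neq.
split=> p X Lp pX.
  have /negP nadm : ~~ admissible (upd p X).
    by apply: upd_not_adm; rewrite Lp proper_card.
  (* Enlarging the set at [p] can only spoil pairs whose later index is [p]. *)
  case: (boolP [exists i : 'I_N, [&& i < p, linked i p & A i \subset X]]).
    by case/existsP => i /andP[ltip iP]; exists i.
  move=> /existsPn no; case: nadm; apply/admissibleP => i j ltij lij.
  rewrite !ffunE; have [eqi|nei] := eqVneq i p; have [eqj|nej] := eqVneq j p.
  - by move: ltij; rewrite eqi eqj ltnn.
  - apply: contra (AP i j ltij lij); rewrite eqi; apply: subset_trans.
    exact: proper_sub.
  - by have := no i; rewrite -eqj ltij lij.
  - exact: AP.
have /negP nadm : ~~ admissible (upd p X).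
  by apply: upd_not_adm; rewrite (negbTE Lp) proper_card // properC.
(* Shrinking the set at [p] can only spoil pairs whose earlier index is [p]. *)
case: (boolP [exists j : 'I_N, [&& p < j, linked p j & X \subset A j]]).
  by case/existsP => j /andP[ltpj jP]; exists j.
move=> /existsPn no; case: nadm; apply/admissibleP => i j ltij lij.
rewrite !ffunE; have [eqi|nei] := eqVneq i p; have [eqj|nej] := eqVneq j p.
- by move: ltij; rewrite eqi eqj ltnn.
- by have := no j; rewrite -eqi ltij lij.
- apply: contra (AP i j ltij lij); rewrite eqj => /subset_trans; apply.
  exact: proper_sub.
- exact: AP.
Qed.

End SetSequences.

(** * Lower bound from the intervals *)

Section Intervals.
Variable n : nat.
Hypothesis n_gt1 : 1 < n.

Let N := 2 ^ n + 1.

(* The ordinal [i : 'I_N] stands for the point [i.+1]. *)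
Definition linked (i j : 'I_N) : bool :=
  [exists l : 'I_n.+1, in_I n l i.+1 && in_I n l j.+1].

Lemma linked_in_I l (i j : 'I_N) :
  l <= n -> in_I n l i.+1 -> in_I n l j.+1 -> linked i j.
Proof.
by move=> lel li lj; apply/existsP; exists (inord l); rewrite inordK ?li.
Qed.

Lemma no_admissible (A0 : {ffun 'I_N -> {set 'I_n}}) : ~~ admissible linked A0.
Proof.
apply/negP => /(admissible_extremal (fun p => p < 2 ^ n.-1))[A] /admissibleP AP.
move=> [Amax Amin].
have e1 : 2 ^ n = 2 * 2 ^ n.-1 by rewrite -expnS prednK // ltnW.
have e2 : 2 <= 2 ^ n.-1 by rewrite -{1}(expn1 2) leq_exp2l; lia.
have cardC p : #|~: A p| = n - #|A p| by rewrite cardsCs setCK card_ord.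
have cardle p : #|A p| <= n by rewrite -[leqRHS](card_ord n) max_card.
have low (p : 'I_N) : p < 2 ^ n.-1 -> 2 ^ #|~: A p| <= p.+1.
  move=> ltp; apply: supersets_occur_before => q X leqp pX.
  by have [|i ltiq /andP[_ sX]] := Amax q X _ pX; [lia | exists i].
have high (p : 'I_N) : 2 ^ n.-1 <= p -> 2 ^ #|A p| <= N - p.
  (* Reversal and complementation exchange small sets on the upper side with large sets on the lower
     side. *)
  move=> gep; pose B (q : 'I_N) := ~: A (rev_ord q).
  have -> : #|A p| = #|~: B (rev_ord p)| by rewrite /B rev_ordK setCK.
  have -> : N - p = (rev_ord p).+1 by rewrite /=; have := ltn_ord p; lia.
  apply: supersets_occur_before => q X /= leqp pX.
  have [||j ltj /andP[_ sX]] := Amin (rev_ord q) (~: X).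
  - by rewrite -leqNgt /=; have := ltn_ord q; have := ltn_ord p; lia.
  - by rewrite -properC setCK.
  exists (rev_ord j); last by rewrite /B rev_ordK -setCS setCK.
  by move: ltj; rewrite /=; have := ltn_ord q; have := ltn_ord j; lia.
have in_own (p : 'I_N) : in_I n #|~: A p| p.+1.
  have expA : 2 ^ (n - #|~: A p|) = 2 ^ #|A p| by rewrite cardC subKn.
  rewrite /in_I expA; have [ltp|gep] := ltnP p (2 ^ n.-1).
    rewrite low // andTb; have [lt1|ge2] := ltnP p 2.
      have : 2 ^ #|A p| <= 2 ^ n by rewrite leq_exp2l.
      lia.
    have : 2 ^ #|A p| <= 2 ^ n.-1; last by lia.
    (* A full [A p] would contain the set at the point 2, the ordinal 1, although both points lie in
       [I_1]. *)
    rewrite leq_exp2l // leqNgt; apply/negP => gtA.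
    have eqn : #|A p| = n by have := cardle p; lia.
    have Np : 1 < N by rewrite /N; lia.
    have lp : linked (Ordinal Np) p.
      by apply: (@linked_in_I 1); rewrite ?/in_I ?subn1 /=; lia.
    have := AP (Ordinal Np) p ge2 lp.
    suff -> : A p = setT by rewrite subsetT.
    by apply/eqP; rewrite eqEcard subsetT cardsT card_ord eqn leqnn.
  have lep : p < 2 ^ n + 1 := ltn_ord p.
  have hip : 2 ^ #|A p| <= 2 ^ n + 1 - p := high p gep.
  have [ltp|] := ltnP p.+1 (2 ^ n); last first.
    have : 2 ^ #|~: A p| <= 2 ^ n by rewrite leq_exp2l // cardC leq_subr.
    lia.
  have : 2 ^ #|~: A p| <= 2 ^ n.-1; last by lia.
  (* An empty [A p] would lie inside the set at the point [2 ^ n], although both points lie in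
     [I_(n-1)]. *)
  rewrite leq_exp2l // cardC; case: (posnP #|A p|) => [A0p|]; last by lia.
  have Np : (2 ^ n).-1 < N by rewrite /N; lia.
  have e3 : n - n.-1 = 1 by lia.
  have lp : linked p (Ordinal Np).
    by apply: (@linked_in_I n.-1); rewrite ?/in_I ?e3 /=; lia.
  have ltp' : p < Ordinal Np by rewrite /=; lia.
  by have := AP p _ ltp' lp; rewrite (cards0_eq A0p) sub0set.
have injA : injective A.
  (* Equal sets miss equally many colours, so [in_own] places both points in one interval. *)
  move=> i j eqA; apply/val_inj/eqP/contraT; rewrite neq_ltn.
  have lij : linked i j.
    apply: (@linked_in_I #|~: A i|); rewrite ?in_own ?cardC ?leq_subr //.
    by rewrite -cardC eqA.
  have lji : linked j i.
    by case/existsP: lij => l lP; apply/existsP; exists l; rewrite andbC.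
  by case/orP => lt; [have := AP i j lt lij | have := AP j i lt lji];
     rewrite eqA subxx.
have := leq_card A injA; rewrite card_ord -cardsT -powersetT card_powerset.
by rewrite cardsT card_ord /N; lia.
Qed.

(** The colour of the arc from [i] to [j] leaves [i], but no arc leaving [j] can have it. *)
Lemma not_colorable_W : ~~ colorable (induced (W n)) n.
Proof.
apply/negP => /colorableP[f fP].
pose A := [ffun i : 'I_N => [set f v | v in
  [pred v : induced (W n) | fst_pt (val v) == i.+1]]].
have /negP[] := no_admissible A; apply/admissibleP => i j ltij lij.
have ordP (k : 'I_N) : k.+1 < N.+1 := ltn_ord k.
pose p := (Ordinal (ordP i), Ordinal (ordP j)).
have pP : (1 <= p.1) && (p.1 < p.2) by [].
pose u : shift_graph N := Sub p pP.
(* After unfolding, this is exactly [lij]. *)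
have uW : u \in W n by rewrite inE.
pose w : induced (W n) := Sub u uW.
apply/subsetPn; exists (f w); rewrite ffunE.
  by apply/imsetP; exists w; rewrite // inE.
apply/imsetP => -[v]; rewrite inE => /eqP vj eqf.
have : edge w v by apply/orP; left; apply/eqP; rewrite [RHS]vj.
by move/fP; rewrite eqf eqxx.
Qed.

End Intervals.

Theorem theorem4 (n : nat) (hn : 2 <= n) :
  chromatic_number (induced (W n)) = chromatic_number (shift_graph (2 ^ n + 1)) /\
  chromatic_number (shift_graph (2 ^ n + 1)) = n + 1.
Proof.
have le1 : chromatic_number (shift_graph (2 ^ n + 1)) <= n + 1.
  apply/chromatic_number_le/shift_graph_colorable.
  (* All labels are below [2 ^ (n + 1)], so they have [n + 1] binary digits. *)
  by rewrite expnD expn1; have := ltn_expl n (ltnSn 1); lia.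
have le2 : chromatic_number (induced (W n)) <=
           chromatic_number (shift_graph (2 ^ n + 1)).
  exact/chromatic_number_le/colorable_induced/chromatic_number_colorable.
have gt : n < chromatic_number (induced (W n)).
  rewrite ltnNge; apply: contra (not_colorable_W hn) => le.
  exact: colorable_widen le (chromatic_number_colorable _).
by lia.
Qed.
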